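(* Let $\tau=\frac12(1+\sqrt5)$. Then $L_\oplus(-\tau)=2$ and $L_\otimes(-\tau)=2$.
   Context: Ito–Sadahiro $(-\beta)$-expansions. For real $\beta>1$ put $l_\beta=-\frac{\beta}{\beta+1}$, $r_\beta=1+l_\beta=\frac{1}{\beta+1}$, and define $T_{-\beta}:[l_\beta,r_\beta)\to[l_\beta,r_\beta)$ by $T_{-\beta}(y)=-\beta y-\lfloor-\beta y-l_\beta\rfloor$. For $y\in[l_\beta,r_\beta)$ put $d_{-\beta}(y)=y_1y_2y_3\cdots$ where $y_i=\lfloor-\beta T_{-\beta}^{i-1}(y)-l_\beta\rfloor$ for $i\ge1$; then $y=\sum_{i\ge1}y_i(-\beta)^{-i}$. For $x\in\mathbb{R}$, a $(-\beta)$-representation of $x$ is an expression $x=\sum_{i=-\infty}^{k}x_i(-\beta)^i$ with $k\in\mathbb{Z}$ and $x_i\in\mathbb{Z}$. The $(-\beta)$-expansion of $x$ is the $(-\beta)$-representation for which $x_kx_{k-1}x_{k-2}\cdots=d_{-\beta}(y)$ for some $y$ in the open interval $(l_\beta,r_\beta)$; it exists and is unique up to leading zeros. The set $\mathbb{Z}_{-\beta}$ of $(-\beta)$-integers consists of all $x\in\mathbb{R}$ whose $(-\beta)$-expansion has $x_i=0$ for all $i<0$, and $\mathrm{Fin}(-\beta)=\bigcup_{k\in\mathbb{Z}}(-\beta)^k\mathbb{Z}_{-\beta}$. Define $$L_\oplus(-\beta)=\min\{l\in\mathbb{N}\mid \forall\,x,y\in\mathbb{Z}_{-\beta},\ x+y\in\mathrm{Fin}(-\beta)\Rightarrow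 x+y\in(-\beta)^{-l}\mathbb{Z}_{-\beta}\},$$ $$L_\otimes(-\beta)=\min\{l\in\mathbb{N}\mid \forall\,x,y\in\mathbb{Z}_{-\beta},\ x\cdot y\in\mathrm{Fin}(-\beta)\Rightarrow x\cdot y\in(-\beta)^{-l}\mathbb{Z}_{-\beta}\}.$$ *)

(* Defs.v *)
From Stdlib Require Import ZArith Reals Zfloor.
From Coquelicot Require Import Coquelicot.

Open Scope R_scope.

(* All notions are parametrized by the positive real beta; the base is
   [- beta], and the definitions are meaningful for [1 < beta]. *)

Definition l_ (beta : R) : R := - (beta / (beta + 1)).

Definition r_ (beta : R) : R := 1 + l_ beta.

(* The transformation T_{-beta} of [l_beta, r_beta); the formula is stated on
   the whole of R but only ever used from starting points of that interval,
   which it maps into itself. *)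
Definition T_ (beta y : R) : R := - beta * y - IZR (Zfloor (- beta * y - l_ beta)).

(* [digit beta y n] is the digit y_{n+1} of
   d_{-beta}(y) = y_1 y_2 y_3 ..., that is,
   floor (- beta T^n(y) - l_beta). *)
Definition digit (beta y : R) (n : nat) : Z :=
  Zfloor (- beta * Nat.iter n (T_ beta) y - l_ beta).

(* x = sum_{i = -oo}^{k} a_i (-beta)^i, summed from i = k downwards; digits at
   positions above k are by convention zero. *)
Definition is_representation (beta x : R) (k : Z) (a : Z -> Z) : Prop :=
  (forall i : Z, (k < i)%Z -> a i = 0%Z) /\
  is_series (fun n : nat =>
    IZR (a (k - Z.of_nat n)%Z) * powerRZ (- beta) (k - Z.of_nat n)) x.

Definition is_expansion (beta x : R) (k : Z) (a : Z -> Z) : Prop :=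
  is_representation beta x k a /\
  exists y : R, l_ beta < y < r_ beta /\
    forall n : nat, a (k - Z.of_nat n)%Z = digit beta y n.

(* The (-beta)-expansion is unique up to leading zeros, i.e. up to the choice
   of k, so quantifying existentially over the expansion is harmless. *)
Definition beta_integer (beta x : R) : Prop :=
  exists (k : Z) (a : Z -> Z),
    is_expansion beta x k a /\ forall i : Z, (i < 0)%Z -> a i = 0%Z.

(* x belongs to (-beta)^k Z_{-beta} *)
Definition scaled_beta_integer (beta : R) (k : Z) (x : R) : Prop :=
  exists z : R, beta_integer beta z /\ x = powerRZ (- beta) k * z.

Definition Fin (beta x : R) : Prop :=
  exists k : Z, scaled_beta_integer beta k x.

Definition is_least_nat (P : nat -> Prop) (n : nat) : Prop :=
  P n /\ forall m : nat, P m -> (n <= m)%nat.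

(* The minima below need not exist for arbitrary beta, so "L(-beta) = l" is
   rendered as a relation: the set is nonempty and l is its least element. *)
Definition L_plus_is (beta : R) (l : nat) : Prop :=
  is_least_nat (fun l => forall x y : R,
    beta_integer beta x -> beta_integer beta y ->
    Fin beta (x + y) ->
    scaled_beta_integer beta (- Z.of_nat l) (x + y)) l.

Definition L_times_is (beta : R) (l : nat) : Prop :=
  is_least_nat (fun l => forall x y : R,
    beta_integer beta x -> beta_integer beta y ->
    Fin beta (x * y) ->
    scaled_beta_integer beta (- Z.of_nat l) (x * y)) l.

Definition tau : R := / 2 * (1 + sqrt 5).

(* Main.v *)
Require Import Defs.
From Stdlib Require Import ZArith Reals Zfloor Lra Lia.
From Coquelicot Require Import Coquelicot.
Open Scope R_scope.

(** Write [w'] for the Galois conjugate of [w] in [Z[tau]].  Since [- tau] has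
    conjugate [/ tau], conjugation turns [T_ tau] into the contraction
    [c |-> c / tau - d], where [d] is 0 or 1, so an orbit starting in [Z[tau]]
    is trapped in a region that contains few lattice points.  It follows that
    the [(-tau)]-integers are the [w] in [Z[tau]] with [0 <= w' < tau ^ 2], and
    hence [(-tau) ^ (-l)] times the [(-tau)]-integers are those with
    [0 <= w' < tau ^ (l + 2)].  Sums and products of two [(-tau)]-integers have
    conjugate below [2 * tau ^ 2 < tau ^ 4] and [tau ^ 4], whereas [3 + tau],
    with conjugate [4 - tau > 2.38], has its double and its square at conjugate
    above [tau ^ 3]. *)

(** * Arithmetic of [tau] and of the ring Z[tau] *)

Definition lattice (a b : Z) : R := IZR a + IZR b * tau.

Definition conj (a b : Z) : R := IZR a + IZR b * (1 - tau).

Lemma tau_bounds : 1.618 < tau < 1.6181.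
Proof.
unfold tau.
assert (H := sqrt_sqrt 5 ltac:(lra)); assert (H0 := sqrt_pos 5).
split; nra.
Qed.

Lemma tau_sq : tau * tau = tau + 1.
Proof. unfold tau; assert (H := sqrt_sqrt 5 ltac:(lra)); nra. Qed.

Lemma inv_tau : / tau = tau - 1.
Proof.
assert (H := tau_sq); assert (B := tau_bounds).
apply Rmult_eq_reg_l with tau; [rewrite Rinv_r; lra | lra].
Qed.

Lemma inv_opp_tau : / - tau = 1 - tau.
Proof.
assert (B := tau_bounds); rewrite Rinv_opp, inv_tau; lra.
Qed.

Lemma l_tau : l_ tau = 1 - tau.
Proof.
assert (H := tau_sq); assert (B := tau_bounds).
unfold l_; apply Rmult_eq_reg_r with (tau + 1); [field_simplify; nra | lra].
Qed.

Lemma r_tau : r_ tau = 2 - tau.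
Proof. unfold r_; rewrite l_tau; lra. Qed.

(** Infinite descent: the form is odd unless [a] and [b] are both even, and then both can be halved.
    The bound [n] is the induction measure. *)
Lemma norm_form_eq0 (n : nat) (a b : Z) :
  (Z.abs_nat a + Z.abs_nat b < n)%nat -> (a * a + a * b - b * b = 0)%Z ->
  a = 0%Z /\ b = 0%Z.
Proof.
revert a b; induction n as [|n IH]; intros a b Hn H; [lia|].
destruct (Z.Even_or_Odd a) as [[u ->]|[u ->]];
  destruct (Z.Even_or_Odd b) as [[v ->]|[v ->]]; try lia.
destruct (Z.eq_dec u 0) as [->|Hu]; [nia|].
destruct (IH u v); lia.
Qed.

(** The norm of the difference is the difference times its conjugate, hence 0. Thus [conj], defined
    on coordinates, depends only on the real number [lattice a b]. *)
Lemma lattice_inj (a b c d : Z) : lattice a b = lattice c d -> a = c /\ b = d.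
Proof.
intros H.
assert (E : lattice (a - c) (b - d) = 0)
  by (unfold lattice in *; rewrite !minus_IZR; lra).
assert (N : ((a - c) * (a - c) + (a - c) * (b - d) - (b - d) * (b - d) = 0)%Z).
{ apply eq_IZR.
  rewrite minus_IZR, plus_IZR, !mult_IZR.
  unfold lattice in E; assert (Q := tau_sq).
  set (p := IZR (a - c)) in *; set (q := IZR (b - d)) in *.
  replace (p * p + p * q - q * q) with ((p + q * tau) * (p + q * (1 - tau)))
    by ring [Q].
  rewrite E; ring. }
destruct (norm_form_eq0 _ _ _ (Nat.lt_succ_diag_r _) N); lia.
Qed.

(** * Digits and orbits of [T_ tau] *)

(** On this interval [- tau * y - l_ tau] ranges over (0, tau], and tau < 2. *)
Lemma digit_step (y : R) : l_ tau <= y < r_ tau ->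
  exists d : Z, (d = 0 \/ d = 1)%Z /\ Zfloor (- tau * y - l_ tau) = d /\
    T_ tau y = - tau * y - IZR d /\ l_ tau <= T_ tau y < r_ tau.
Proof.
intros Hy; exists (Zfloor (- tau * y - l_ tau)).
unfold T_.
assert (B := Zfloor_bound (- tau * y - l_ tau)).
assert (Q := tau_sq); assert (Bt := tau_bounds).
rewrite l_tau, r_tau in *.
set (d := Zfloor _) in *.
repeat split; try lra.
assert (H1 : -1 < IZR d) by nra.
assert (H2 : IZR d < 2) by nra.
apply lt_IZR in H1; apply lt_IZR in H2; lia.
Qed.

Lemma orbit_interval (y : R) (n : nat) : l_ tau <= y < r_ tau ->
  l_ tau <= Nat.iter n (T_ tau) y < r_ tau.
Proof.
intros Hy; induction n as [|n IH]; [exact Hy|].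
destruct (digit_step _ IH) as (d & _ & _ & _ & H); exact H.
Qed.

Lemma digit01 (y : R) (n : nat) : l_ tau <= y < r_ tau ->
  (digit tau y n = 0 \/ digit tau y n = 1)%Z.
Proof.
intros Hy; destruct (digit_step _ (orbit_interval y n Hy)) as (d & H & E & _).
unfold digit; rewrite E; exact H.
Qed.

(** * The conjugate of a [(-tau)]-integer lies in [0, tau^2) *)

Fixpoint horner (d : nat -> Z) (n : nat) : R :=
  match n with
  | O => 0
  | S n => - tau * horner d n + IZR (d n)
  end.

Lemma horner_ext (d e : nat -> Z) (n : nat) :
  (forall i, d i = e i) -> horner d n = horner e n.
Proof.
intros H; induction n as [|n IH]; simpl; [reflexivity|].
rewrite IH, H; reflexivity.
Qed.

(** On conjugates a Horner step is c |-> c / tau + d. The bound tau^2 is the fixed point of c |-> c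
    / tau + 1. *)
Lemma horner_window (d : nat -> Z) (n : nat) :
  (forall i, (d i = 0 \/ d i = 1)%Z) ->
  exists a b : Z, horner d n = lattice a b /\ 0 <= conj a b < tau ^ 2.
Proof.
intros Hd; assert (Q := tau_sq); assert (B := tau_bounds).
induction n as [|n (a & b & E & C)]; simpl horner.
- exists 0%Z, 0%Z; unfold lattice, conj; split; nra.
- exists (d n - b)%Z, (- a - b)%Z; rewrite E; unfold lattice, conj in *.
  rewrite !minus_IZR, opp_IZR; split; [ring [Q]|].
  assert (F : IZR (d n) - IZR b + (- IZR a - IZR b) * (1 - tau)
     = IZR (d n) + (IZR a + IZR b * (1 - tau)) * (tau - 1)) by ring [Q].
  rewrite F.
  destruct (Hd n) as [-> | ->]; nra.
Qed.

Lemma horner_digit (y : R) (n : nat) :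
  horner (digit tau y) n = (- tau) ^ n * y - Nat.iter n (T_ tau) y.
Proof.
induction n as [|n IH]; simpl; [ring|].
rewrite IH; unfold T_ at 2, digit; ring.
Qed.

(** [sum_n] adds the terms 0 to [n], so [S n] digits enter the Horner value. *)
Lemma partial_sum_horner (a : Z -> Z) (k : Z) (n : nat) :
  sum_n (fun j => IZR (a (k - Z.of_nat j)%Z) * powerRZ (- tau) (k - Z.of_nat j)) n
  = powerRZ (- tau) (k - Z.of_nat n)
    * horner (fun j => a (k - Z.of_nat j)%Z) (S n).
Proof.
assert (B := tau_bounds).
induction n as [|n IH].
- rewrite sum_O; simpl; ring.
- rewrite sum_Sn, IH; unfold plus; cbn -[Z.of_nat powerRZ].
  replace (k - Z.of_nat n)%Z with (k - Z.of_nat (S n) + 1)%Z by lia.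
  rewrite powerRZ_add by lra; rewrite powerRZ_1; ring.
Qed.

Lemma is_series_eventually_zero (u : nat -> R) (n : nat) :
  (forall m, (n < m)%nat -> u m = 0) -> is_series u (sum_n u n).
Proof.
intros H.
change (is_lim_seq (sum_n u) (sum_n u n)).
apply (is_lim_seq_ext_loc (fun _ => sum_n u n)); [|apply is_lim_seq_const].
exists n; intros m Hm; induction Hm as [|m Hm IH]; [reflexivity|].
rewrite sum_Sn, (H (S m)), <- IH by lia.
symmetry; apply Rplus_0_r.
Qed.

Lemma is_representation_integer (x : R) (N : nat) (a : Z -> Z) :
  (forall i, (i < 0)%Z -> a i = 0%Z) ->
  is_series (fun n => IZR (a (Z.of_nat N - Z.of_nat n)%Z)
               * powerRZ (- tau) (Z.of_nat N - Z.of_nat n)) x <->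
  x = horner (fun j => a (Z.of_nat N - Z.of_nat j)%Z) (S N).
Proof.
intros Ha.
assert (H : is_series (fun n => IZR (a (Z.of_nat N - Z.of_nat n)%Z)
               * powerRZ (- tau) (Z.of_nat N - Z.of_nat n))
            (horner (fun j => a (Z.of_nat N - Z.of_nat j)%Z) (S N))).
{ rewrite <- (Rmult_1_l (horner _ _)).
  change 1 with (powerRZ (- tau) 0).
  rewrite <- (Z.sub_diag (Z.of_nat N)), <- partial_sum_horner.
  apply is_series_eventually_zero.
  intros m Hm; rewrite Ha by lia; ring. }
split; [|intros ->; exact H].
intros H'; rewrite <- (is_series_unique _ _ H'); apply is_series_unique, H.
Qed.

Lemma beta_integer_window (x : R) : beta_integer tau x ->
  exists a b : Z, x = lattice a b /\ 0 <= conj a b < tau ^ 2.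
Proof.
intros (k & a & ((Hk & Hs) & (y & Hy & Hd)) & Ha).
destruct (Z_lt_le_dec k 0) as [Hk0|Hk0].
(* With k < 0 every digit vanishes and x = 0. *)
- exists 0%Z, 0%Z; assert (B := tau_bounds); split.
  + rewrite <- (is_series_unique _ _ Hs).
    apply is_series_unique.
    replace (lattice 0 0) with (sum_n (fun n : nat => IZR (a (k - Z.of_nat n)%Z)
      * powerRZ (- tau) (k - Z.of_nat n)) 0)
      by (rewrite sum_O, Ha by lia; unfold lattice; simpl; ring).
    apply is_series_eventually_zero; intros m _; rewrite Ha by lia; ring.
  + unfold conj; nra.
- rewrite <- (Z2Nat.id k Hk0) in Hs.
  apply is_representation_integer in Hs; [|exact Ha].
  rewrite Hs; apply horner_window.
  rewrite (Z2Nat.id k Hk0); intros i; rewrite Hd; apply digit01; lra.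
Qed.

(** * Every point of Z[tau] with conjugate in [0, tau^2) is a [(-tau)]-integer *)

Lemma scale_inv (n : nat) (a b : Z) : exists a' b' : Z,
  (/ - tau) ^ n * lattice a b = lattice a' b' /\ conj a' b' = tau ^ n * conj a b.
Proof.
assert (Q := tau_sq).
induction n as [|n (a' & b' & E & C)].
- exists a, b; simpl; split; ring.
- exists (a' - b')%Z, (- a')%Z; simpl.
  rewrite !Rmult_assoc, E, <- C, inv_opp_tau; unfold lattice, conj.
  rewrite minus_IZR, opp_IZR; split; ring [Q].
Qed.

(** Each step c |-> c / tau - d lowers the exponent of the upper bound by one. The lower bound -
    tau^2 is the fixed point of c |-> c / tau - 1, so it persists. *)
Lemma orbit_conj (y : R) (a b : Z) (n m : nat) :
  l_ tau <= y < r_ tau -> y = lattice a b ->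
  0 <= conj a b < tau ^ (n + m + 2) ->
  exists a' b' : Z, Nat.iter n (T_ tau) y = lattice a' b' /\
    - tau ^ 2 < conj a' b' < tau ^ (m + 2).
Proof.
intros Hy Ey; assert (Q := tau_sq); assert (B := tau_bounds).
revert m; induction n as [|n IH]; intros m C.
- exists a, b; simpl in *; split; [exact Ey|nra].
- destruct (IH (S m)) as (a' & b' & E & C').
  { replace (n + S m + 2)%nat with (S n + m + 2)%nat by lia; exact C. }
  destruct (digit_step _ (orbit_interval y n Hy)) as (d & Hd & _ & ET & _).
  exists (- b' - d)%Z, (- a' - b')%Z; simpl Nat.iter; rewrite ET, E.
  unfold lattice, conj in *; rewrite !minus_IZR, !opp_IZR.
  split; [ring [Q]|].
  replace (- IZR b' - IZR d + (- IZR a' - IZR b') * (1 - tau))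
    with ((IZR a' + IZR b' * (1 - tau)) * (tau - 1) - IZR d) by ring [Q].
  simpl (tau ^ (S m + 2)) in C'.
  set (t := tau ^ (m + 2)) in *.
  assert (Ht : 0 < t) by (apply pow_lt; lra).
  set (c := IZR a' + IZR b' * (1 - tau)) in *.
  assert (c * (tau - 1) < t).
  { replace t with (tau * t * (tau - 1)) by ring [Q].
    apply Rmult_lt_compat_r; lra. }
  assert (- tau < c * (tau - 1)).
  { replace (- tau) with (- tau ^ 2 * (tau - 1)) by ring [Q].
    apply Rmult_lt_compat_r; lra. }
  replace (tau ^ 2) with (tau + 1) by ring [Q].
  destruct Hd as [-> | ->]; lra.
Qed.

Lemma small_lattice_point (a b : Z) :
  l_ tau <= lattice a b < r_ tau -> - tau ^ 2 < conj a b < tau ^ 2 ->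
  lattice a b = 0 \/ lattice a b = l_ tau /\ conj a b = tau.
Proof.
rewrite l_tau, r_tau; unfold lattice, conj; intros H C.
assert (Q := tau_sq); assert (B := tau_bounds).
replace (tau ^ 2) with (tau + 1) in C by lra.
(* Subtracting the conjugate from the number leaves b * (2 * tau - 1), which bounds b. *)
assert (Hb1 : IZR b < 2) by nra.
assert (Hb2 : -2 < IZR b) by nra.
apply lt_IZR in Hb1; apply lt_IZR in Hb2.
assert (Hb : (b = 0 \/ b = 1 \/ b = -1)%Z) by lia.
destruct Hb as [-> | [-> | ->]].
- assert (H1 : IZR a < 1) by lra; assert (H2 : -1 < IZR a) by lra.
  apply lt_IZR in H1; apply lt_IZR in H2.
  replace a with 0%Z by lia; left; ring.
(* The only candidate, -2 + tau, has conjugate exactly - tau^2, which the strict bound excludes. *)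
- assert (H1 : IZR a < -1) by lra; assert (H2 : -3 < IZR a) by lra.
  apply lt_IZR in H1; apply lt_IZR in H2.
  replace a with (-2)%Z in * by lia; lra.
- assert (H1 : IZR a < 2) by lra; assert (H2 : 0 < IZR a) by lra.
  apply lt_IZR in H1; apply lt_IZR in H2.
  replace a with 1%Z in * by lia; right; lra.
Qed.

(** [small_lattice_point] leaves only 0 and [l_ tau] after the last step. That step is treated apart
    from [orbit_conj], because its digit and the bound tau^3 just before it exclude [l_ tau]. *)
Lemma orbit_reaches_0 (y : R) (a b : Z) (n : nat) :
  l_ tau <= y < r_ tau -> y = lattice a b -> 0 <= conj a b < tau ^ (S n + 2) ->
  Nat.iter (S n) (T_ tau) y = 0.
Proof.
intros Hy Ey C; assert (Q := tau_sq); assert (B := tau_bounds).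
assert (C1 : 0 <= conj a b < tau ^ (n + 1 + 2))
  by (replace (n + 1 + 2)%nat with (S n + 2)%nat by lia; exact C).
destruct (orbit_conj y a b n 1 Hy Ey C1) as (a' & b' & E & C').
destruct (digit_step _ (orbit_interval y n Hy)) as (d & Hd & _ & ET & HT).
simpl Nat.iter; rewrite ET in HT |- *; rewrite E in HT |- *.
assert (EL : - tau * lattice a' b' - IZR d = lattice (- b' - d) (- a' - b'))
  by (unfold lattice; rewrite !minus_IZR, !opp_IZR; ring [Q]).
assert (EC : conj (- b' - d) (- a' - b') = conj a' b' * (tau - 1) - IZR d)
  by (unfold conj; rewrite !minus_IZR, !opp_IZR; ring [Q]).
assert (U : conj a' b' * (tau - 1) < tau ^ 2).
{ replace (tau ^ 2) with (tau ^ (1 + 2) * (tau - 1)) by (simpl; ring [Q]).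
  apply Rmult_lt_compat_r; lra. }
rewrite EL in HT |- *.
destruct (small_lattice_point _ _ HT) as [Z0 | [Zl Zc]]; [| exact Z0 |].
- rewrite EC; destruct Hd as [-> | ->]; nra.
- exfalso.
  (* A point mapped to [l_ tau] with digit 0 would be [r_ tau], which is
     excluded; with digit 1 its conjugate is too large. *)
  assert (HI := orbit_interval y n Hy).
  rewrite E, l_tau, r_tau in HI; rewrite <- EL, l_tau in Zl; rewrite EC in Zc.
  destruct Hd as [-> | ->]; nra.
Qed.

Lemma exists_large_exponent (x : R) : exists n : nat, Rabs x < tau ^ n.
Proof.
assert (B := tau_bounds).
destruct (Pow_x_infinity tau ltac:(rewrite Rabs_right; lra) (Rabs x + 1)) as [n H].
exists n; specialize (H n (le_n n)).
rewrite (Rabs_right (tau ^ n)) in H; [lra|].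
left; apply pow_lt; lra.
Qed.

(** Dividing by (-tau)^(N+1) brings the number into the interval and multiplies its conjugate by
    tau^(N+1). The orbit then reaches 0 within N+1 steps, so no digit is left at a negative
    position. *)
Lemma window_beta_integer (a b : Z) : 0 <= conj a b < tau ^ 2 ->
  beta_integer tau (lattice a b).
Proof.
intros C; assert (Q := tau_sq); assert (B := tau_bounds).
destruct (exists_large_exponent (lattice a b)) as [n Hn].
(* Here N + 1 = n + 3, so |y| < tau^(-3), which is below both - [l_ tau] and [r_ tau]. *)
set (N := S (S n)).
destruct (scale_inv (S N) a b) as (a' & b' & E & C').
set (y := (/ - tau) ^ S N * lattice a b) in *.
assert (Py : (- tau) ^ S N * y = lattice a b).
{ unfold y; rewrite <- Rmult_assoc, <- Rpow_mult_distr, Rinv_r by lra.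
  rewrite pow1; ring. }
assert (Hy : l_ tau < y < r_ tau).
{ assert (A : Rabs y * tau ^ 3 < 1).
  { assert (P : 0 < tau ^ n) by (apply pow_lt; lra).
    apply Rmult_lt_reg_r with (tau ^ n); [exact P|].
    rewrite Rmult_1_l; apply Rle_lt_trans with (2 := Hn); right.
    rewrite <- Py, Rabs_mult, <- RPow_abs, Rabs_Ropp, (Rabs_right tau) by lra.
    unfold N; simpl; ring. }
  rewrite l_tau, r_tau.
  assert (Ay := Rle_abs y); assert (Ay' := Rle_abs (- y)).
  rewrite Rabs_Ropp in Ay'.
  replace (tau ^ 3) with (2 * tau + 1) in A by ring [Q].
  split; nra. }
assert (Ho : Nat.iter (S N) (T_ tau) y = 0).
{ apply orbit_reaches_0 with a' b'; [lra | exact E |].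
  rewrite C', pow_add.
  assert (P : 0 < tau ^ S N) by (apply pow_lt; lra).
  split; [apply Rmult_le_pos; lra | apply Rmult_lt_compat_l; lra]. }
(* 0 is a fixed point of [T_ tau]: - [l_ tau] = tau - 1 has floor 0. *)
assert (Hz : forall m, (N < m)%nat -> Nat.iter m (T_ tau) y = 0).
{ intros m Hm; induction Hm as [|m Hm IH]; [exact Ho|].
  simpl; rewrite IH; unfold T_.
  rewrite (Zfloor_eq 0); rewrite ?l_tau; lra. }
assert (Hd : forall m, (N < m)%nat -> digit tau y m = 0%Z).
{ intros m Hm; unfold digit; rewrite Hz by exact Hm.
  apply Zfloor_eq; rewrite l_tau; lra. }
set (s := fun i : Z => if (i <=? Z.of_nat N)%Z
            then digit tau y (Z.to_nat (Z.of_nat N - i)) else 0%Z).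
assert (Es : forall j : nat, s (Z.of_nat N - Z.of_nat j)%Z = digit tau y j).
{ intros j; unfold s; rewrite (proj2 (Z.leb_le _ _)) by lia.
  f_equal; lia. }
assert (Hs : forall i, (i < 0)%Z -> s i = 0%Z).
{ intros i Hi; unfold s; destruct (_ <=? _)%Z; [apply Hd; lia | reflexivity]. }
exists (Z.of_nat N), s; split; [split; [split|] | exact Hs].
- intros i Hi; unfold s; rewrite (proj2 (Z.leb_gt _ _)) by lia; reflexivity.
- apply is_representation_integer; [exact Hs|].
  transitivity (horner (digit tau y) (S N)).
  + rewrite horner_digit, Ho, Py; ring.
  + apply horner_ext; intros j; symmetry; apply Es.
- exists y; split; [exact Hy | exact Es].
Qed.

(** * Scaled [(-tau)]-integers and their conjugates *)

Lemma powerRZ_neg (m : nat) : powerRZ (- tau) (- Z.of_nat m) = (/ - tau) ^ m.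
Proof.
assert (B := tau_bounds).
rewrite powerRZ_neg' , <- pow_powerRZ, pow_inv; reflexivity.
Qed.

Lemma window_scaled (a b : Z) : 0 <= conj a b < tau ^ 4 ->
  scaled_beta_integer tau (- Z.of_nat 2) (lattice a b).
Proof.
intros C; assert (Q := tau_sq); assert (B := tau_bounds).
(* This is (-tau)^2 * (a + b * tau); its conjugate is that of a + b * tau divided by tau^2. *)
exists (lattice (a + b) (a + 2 * b)); split.
- apply window_beta_integer.
  replace (conj (a + b) (a + 2 * b)) with (conj a b * (2 - tau))
    by (unfold conj; rewrite !plus_IZR, mult_IZR; ring [Q]).
  split; [apply Rmult_le_pos; lra|].
  replace (tau ^ 2) with (tau ^ 4 * (2 - tau))
    by ring [Q].
  apply Rmult_lt_compat_r; lra.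
- rewrite powerRZ_neg, inv_opp_tau; unfold lattice.
  rewrite !plus_IZR, mult_IZR; ring [Q].
Qed.

Lemma scaled_window (m : nat) (a b : Z) :
  scaled_beta_integer tau (- Z.of_nat m) (lattice a b) ->
  conj a b < tau ^ (m + 2).
Proof.
intros (z & Hz & E); assert (B := tau_bounds).
destruct (beta_integer_window z Hz) as (c & d & -> & C).
rewrite powerRZ_neg in E.
destruct (scale_inv m c d) as (a' & b' & E' & C').
rewrite E' in E; destruct (lattice_inj _ _ _ _ E) as [-> ->].
rewrite C', pow_add; apply Rmult_lt_compat_l; [apply pow_lt|]; lra.
Qed.

Lemma exponent_ge_2 (m : nat) (a b : Z) : tau ^ 3 <= conj a b ->
  scaled_beta_integer tau (- Z.of_nat m) (lattice a b) -> (2 <= m)%nat.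
Proof.
intros C H; apply scaled_window in H; assert (B := tau_bounds).
destruct (Nat.le_gt_cases 2 m) as [Hm|Hm]; [exact Hm|exfalso].
assert (P := Rle_pow tau (m + 2) 3 ltac:(lra) ltac:(lia)); lra.
Qed.

(** * Sums, products and the two minima *)

Lemma lattice_add (a b c d : Z) :
  lattice a b + lattice c d = lattice (a + c) (b + d) /\
  conj (a + c) (b + d) = conj a b + conj c d.
Proof. unfold lattice, conj; rewrite !plus_IZR; split; ring. Qed.

Lemma lattice_mul (a b c d : Z) :
  lattice a b * lattice c d = lattice (a * c + b * d) (a * d + b * c + b * d) /\
  conj (a * c + b * d) (a * d + b * c + b * d) = conj a b * conj c d.
Proof.
assert (Q := tau_sq); unfold lattice, conj; rewrite !plus_IZR, !mult_IZR.
split; ring [Q].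
Qed.

(** This extremal example lies close enough to the top of the window for both its double and its
    square to have conjugates in [tau^3, tau^4). *)
Lemma beta_integer_3_tau : beta_integer tau (lattice 3 1).
Proof.
apply window_beta_integer; assert (Q := tau_sq); assert (B := tau_bounds).
unfold conj; split; nra.
Qed.

Lemma L_plus_tau : L_plus_is tau 2.
Proof.
assert (Q := tau_sq); assert (B := tau_bounds); split.
- intros x y Hx Hy _.
  destruct (beta_integer_window x Hx) as (a & b & -> & C).
  destruct (beta_integer_window y Hy) as (c & d & -> & D).
  destruct (lattice_add a b c d) as [-> E].
  apply window_scaled; rewrite E.
  replace (tau ^ 4) with (tau ^ 2 * (tau + 1)) by ring [Q]; nra.
- intros m Hm.
  assert (H := beta_integer_3_tau).
  specialize (Hm _ _ H H).
  destruct (lattice_add 3 1 3 1) as [E F]; rewrite E in Hm.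
  apply (exponent_ge_2 m (3 + 3) (1 + 1)).
  + rewrite F; unfold conj; simpl; nra.
  + apply Hm; exists (- Z.of_nat 2)%Z; apply window_scaled.
    rewrite F; unfold conj; simpl; nra.
Qed.

Lemma L_times_tau : L_times_is tau 2.
Proof.
assert (Q := tau_sq); assert (B := tau_bounds); split.
- intros x y Hx Hy _.
  destruct (beta_integer_window x Hx) as (a & b & -> & C).
  destruct (beta_integer_window y Hy) as (c & d & -> & D).
  destruct (lattice_mul a b c d) as [-> E].
  apply window_scaled; rewrite E.
  split; [apply Rmult_le_pos; lra|].
  replace (tau ^ 4) with (tau ^ 2 * tau ^ 2) by ring.
  apply Rmult_le_0_lt_compat; lra.
- intros m Hm.
  assert (H := beta_integer_3_tau).
  specialize (Hm _ _ H H).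
  destruct (lattice_mul 3 1 3 1) as [E F]; rewrite E in Hm.
  apply (exponent_ge_2 m _ _) in Hm; [exact Hm| |].
  + rewrite F; unfold conj; simpl; nra.
  + exists (- Z.of_nat 2)%Z; apply window_scaled.
    rewrite F; unfold conj; simpl; nra.
Qed.

Theorem theorem6p2 : L_plus_is tau 2 /\ L_times_is tau 2.
Proof. split; [exact L_plus_tau | exact L_times_tau]. Qed.
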